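(* Let $p(x)\in\mathbb{R}[x_0,\dots,x_n]$ be the implicit polynomial of a rational parameterization $x_i=f_i(t)/g_i(t)$, $i=0,\dots,n$. Let $S=\{s_1,\dots,s_{|S|}\}$ be the set of lattice points of a predicted polytope $Q$ for $p$. Let $M'$ be the $(|S|-1)\times|S|$ interpolation matrix built from generic distinct parameter values $\tau_1,\dots,\tau_{|S|-1}$, and for a point $q$ let $M(q)$ be the $|S|\times|S|$ matrix obtained by appending to $M'$ the row $(q^{s_1},\dots,q^{s_{|S|}})$. Let $q=(q_0,\dots,q_n)\in(\mathbb{R}^* )^{n+1}$, where $\mathbb{R}^*=\mathbb{R}\setminus\{0\}$, be a query point different from all points $x(\tau_k)$, $k=1,\dots,|S|-1$. Then $q$ lies on the hypersurface defined by $p(x)=0$ if and only if $\operatorname{corank}(M(q))=\operatorname{corank}(M')$.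
   Context: Parameterization: $t=(t_1,\dots,t_n)$; $f_i,g_i\in\mathbb{R}[t]$ are nonzero polynomials for $i=0,\dots,n$; $x_i=f_i(t)/g_i(t)$. Write $x(\tau)=(f_0(\tau)/g_0(\tau),\dots,f_n(\tau)/g_n(\tau))$ whenever all $g_i(\tau)\neq0$. Implicit polynomial: the ideal of all polynomials $h\in\mathbb{R}[x_0,\dots,x_n]$ with $h(f_0/g_0,\dots,f_n/g_n)=0$ identically in $t$ is assumed to be a nonzero principal ideal. Its generator is $p(x)$ (unique up to a nonzero scalar), and $p$ is called the implicit polynomial. Polytopes: $P=N(p)\subset\mathbb{R}^{n+1}$ is the Newton polytope of $p$, i.e. the convex hull of the exponent vectors of the monomials of $p$ with nonzero coefficient. The predicted polytope $Q\subset\mathbb{R}_{\ge0}^{n+1}$ is a lattice polytope that contains a translate $a+P$, $a\in\mathbb{Z}^{n+1}$, of $P$ and has nonempty intersection with every coordinate axis. Put $S=Q\cap\mathbb{Z}^{n+1}=\{s_1,\dots,s_{|S|}\}$ and $m_j=x^{s_j}=x_0^{s_{j0}}\cdots x_n^{s_{jn}}$. Matrices: for $\tau\in\mathbb{C}^n$ with all $g_i(\tau)\ne0$, let $m_j|_{t=\tau}=\prod_{i=0}^n (f_i(\tau)/g_i(\tau))^{s_{ji}}$. Fix distinct generic values $\tau_1,\dots,\tau_{|S|-1}\in\mathbb{C}^n$ at which no $g_i$ vanishes. Then $M'$ is the $(|S|-1)\times|S|$ matrix with $(k,j)$ entry $m_j|_{t=\tau_k}$, and $M(q)$ is the $|S|\times|S|$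 matrix whose first $|S|-1$ rows are those of $M'$ and whose last row is $(m_1,\dots,m_{|S|})$ evaluated at $x=q$. The corank of a matrix is the dimension of its (right) nullspace, i.e. its number of columns minus its rank (over $\mathbb{C}$). ''Generic'' means: there is a nonempty Zariski-open subset $U$ of $(\mathbb{C}^n)^{|S|-1}$, depending only on the parameterization and on $Q$ (not on $q$), such that the statement holds for all $(\tau_1,\dots,\tau_{|S|-1})\in U$. *)

(* Defs.v *)
From mathcomp Require Export all_boot all_order all_algebra.
From mathcomp Require Export boolp classical_sets reals.
From mathcomp Require Export complex mpoly.

Set Implicit Arguments.
Unset Strict Implicit.
Unset Printing Implicit Defensive.

Import Order.TTheory GRing.Theory Num.Theory.

Local Open Scope classical_set_scope.
Local Open Scope ring_scope.

(* The empty sequence spans the empty set, since its weights sum to 0. *)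
Definition conv_hull (R : realType) (d : nat) (V : seq 'rV[R]_d) :
    set 'rV[R]_d :=
  [set x | exists w : 'I_(size V) -> R,
     [/\ forall k, 0 <= w k, \sum_k w k = 1 & x = \sum_k w k *: V`_k]].

Definition int_vec (R : realType) (d : nat) (v : 'rV[int]_d) : 'rV[R]_d :=
  map_mx intr v.

Definition lattice_polytope (R : realType) (d : nat) (Q : set 'rV[R]_d) :
    Prop :=
  exists V : seq 'rV[int]_d, Q = conv_hull (map (@int_vec R d) V).

Definition newton_polytope (R : realType) (d : nat) (p : {mpoly R[d]}) :
    set 'rV[R]_d :=
  conv_hull [seq \row_i (m i)%:R | m : 'X_{1..d} <- msupp p].

Definition predicted_polytope (R : realType) (d : nat) (p : {mpoly R[d]})
    (Q : set 'rV[R]_d) : Prop :=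
  [/\ lattice_polytope Q,
      forall y i, Q y -> 0 <= y 0 i,
      exists a : 'rV[int]_d,
        forall y, newton_polytope p y -> Q (int_vec R a + y)
    & forall i, exists2 y, Q y & forall j, j != i -> y 0 j = 0].

(* [Q] is later required to lie in the nonnegative orthant, so the entries of
   the vectors of [s] are nonnegative exponents. *)
Definition enumerates_lattice_points (R : realType) (d : nat)
    (Q : set 'rV[R]_d) (s : seq 'rV[int]_d) : Prop :=
  uniq s /\ forall v, (v \in s) <-> Q (int_vec R v).

(* [h] vanishes identically after the substitution [x_i := f_i / g_i], an
   identity between elements of the fraction field of the polynomial ring. *)
Definition vanishes_on_param (R : realType) (n d : nat)
    (f g : 'I_d -> {mpoly R[n]}) (h : {mpoly R[d]}) : Prop :=
  mmap (fun c : R => tofrac (c%:MP_[n]))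
       (fun i => tofrac (f i) / tofrac (g i)) h = 0.

(* The second clause says that the ideal of relations is the principal ideal
   generated by [p]. *)
Definition implicit_polynomial (R : realType) (n d : nat)
    (f g : 'I_d -> {mpoly R[n]}) (p : {mpoly R[d]}) : Prop :=
  p != 0 /\
  forall h, vanishes_on_param f g h <-> exists r : {mpoly R[d]}, h = r * p.

Definition ceval (R : realType) (n : nat) (h : {mpoly R[n]})
    (z : 'rV[R[i]]_n) : R[i] :=
  (map_mpoly (real_complex R) h).@[fun i => z 0 i].

Definition param_point (R : realType) (n d : nat)
    (f g : 'I_d -> {mpoly R[n]}) (z : 'rV[R[i]]_n) : 'rV[R[i]]_d :=
  \row_i (ceval (f i) z / ceval (g i) z).

Definition complex_point (R : realType) (d : nat) (q : 'rV[R]_d) :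
    'rV[R[i]]_d :=
  map_mx (real_complex R) q.

Definition monomial_row (K : fieldType) (d : nat) (s : seq 'rV[int]_d)
    (x : 'rV[K]_d) : 'rV[K]_(size s) :=
  \row_j \prod_i (x 0 i) ^ (s`_j 0 i).

(* The parameter values are the rows of [tau]. *)
Definition interp_mx (R : realType) (n d : nat)
    (f g : 'I_d -> {mpoly R[n]}) (s : seq 'rV[int]_d) (N : nat)
    (tau : 'M[R[i]]_(N, n)) : 'M[R[i]]_(N, size s) :=
  \matrix_(k < N) monomial_row s (param_point f g (row k tau)).

(* With [N = (size s).-1] this is a square matrix as soon as [s] is nonempty. *)
Definition query_mx (R : realType) (n d : nat)
    (f g : 'I_d -> {mpoly R[n]}) (s : seq 'rV[int]_d) (N : nat)
    (tau : 'M[R[i]]_(N, n)) (q : 'rV[R]_d) : 'M[R[i]]_(N + 1, size s) :=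
  col_mx (interp_mx f g s tau) (monomial_row s (complex_point q)).

Definition corank (K : fieldType) (m n : nat) (A : 'M[K]_(m, n)) : nat :=
  (n - \rank A)%N.

(* The complement of the common zero set of a family [F] of polynomials. *)
Definition zariski_open (K : fieldType) (d : nat) (U : set 'rV[K]_d) : Prop :=
  exists F : set {mpoly K[d]},
    U = [set z | exists2 h, F h & h.@[fun i => z 0 i] != 0].

(* Main.v *)
Require Import Defs.

Set Implicit Arguments.
Unset Strict Implicit.
Unset Printing Implicit Defensive.

Import Order.TTheory GRing.Theory Num.Theory.

Local Open Scope classical_set_scope.
Local Open Scope ring_scope.

(** Multiplying row [k] of the interpolation matrix by the nonzero number
    [\prod_i g_i(tau_k) ^ D], with [D] at least every exponent in [s], replaces
    its entries by the values at [tau_k] of the polynomials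
    [F_j = \prod_i f_i ^ s_ji * g_i ^ (D - s_ji)].  A linear relation
    [\sum_j c_j F_j = 0] means exactly that [\sum_j c_j x^s_j] vanishes on the
    parameterization ([vanishes_lat_poly]), and such a [c] is always in the
    kernel of the interpolation matrix.

    The essential point is the converse for generic [tau]: the kernel contains
    nothing but relations ([generic_eval_kernel]).  Points are chosen greedily:
    as long as some kernel vector is not a relation, a point where the
    corresponding combination of the [F_j] is nonzero raises the rank by one.
    Since [|S| - 1] points are available and there is a nonzero relation, the
    process ends with the right kernel; the rank reached there is guaranteed at
    other [tau] by the nonvanishing of one determinant, an open condition that
    therefore forces the same kernel.

    Appending the row of [q] preserves the corank if and only if that row lies
    in the row space of the interpolation matrix, that is, if and only if it is
    killed by every relation.  The real and imaginary parts of a relation are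
    the coefficient vectors of multiples of [p] ([linrel_Re_Im],
    [vanishes_lat_poly]), so they kill the row of [q] when [p(q) = 0]
    ([implicit_linrel_eval]).  Conversely, [x^a p] has its support in [S]
    ([predicted_shift]) and its coefficients form a relation
    ([implicit_shift_linrel]), whence [q^a p(q) = 0] and [p(q) = 0], all
    coordinates of [q] being nonzero.  This relation also provides the nonzero
    relation needed above. *)

(** * Row spaces and corank *)

Section RowSpaces.

Variables (K : fieldType) (m : nat).

(** The row space is the annihilator of the right kernel. *)
Lemma submx_of_ker N1 N2 (A : 'M[K]_(N1, m)) (B : 'M[K]_(N2, m)) :
  (forall c : 'cV_m, B *m c = 0 -> A *m c = 0) -> (A <= B)%MS.
Proof.
move=> BA; rewrite submxE; apply/eqP/matrixP => i j.
have /BA : B *m col j (cokermx B) = 0.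
  by rewrite colE mulmxA mulmx_coker mul0mx.
by rewrite colE mulmxA -colE => /colP /(_ i); rewrite !mxE.
Qed.

Lemma corank_col_mx N1 N2 (A : 'M[K]_(N1, m)) (B : 'M[K]_(N2, m)) :
  corank (col_mx A B) = corank A <-> (B <= A)%MS.
Proof.
have AAB : (A <= col_mx A B)%MS by rewrite -addsmxE addsmxSl.
have -> : (B <= A)%MS = (\rank (col_mx A B) <= \rank A)%N.
  by rewrite (geq_leqif (mxrank_leqif_sup AAB)) -addsmxE addsmx_sub submx_refl.
rewrite /corank; split=> [/(congr1 (subn m))|rk].
  by rewrite !subKn ?rank_leq_col // => ->.
by congr (_ - _)%N; apply/eqP; rewrite eqn_leq rk mxrankS.
Qed.

End RowSpaces.

(** * Nonvanishing of polynomials *)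

Lemma poly_nonroot (K : numDomainType) (p : {poly K}) :
  p != 0 -> exists x, p.[x] != 0.
Proof.
move=> p0; apply: contrapT => H.
have := @max_poly_roots _ p [seq i%:R | i <- iota 0 (size p)] p0.
rewrite size_map size_iota ltnn map_inj_uniq ?iota_uniq; last first.
  by move=> i j /eqP; rewrite eqr_nat => /eqP.
suff -> : all (root p) [seq i%:R | i <- iota 0 (size p)] by move=> /(_ isT isT).
by apply/allP => x _; apply/negPn/negP => px; apply: H; exists x.
Qed.

Lemma mpoly_nonroot (K : numDomainType) (n : nat) (p : {mpoly K[n]}) :
  p != 0 -> exists v, p.@[v] != 0.
Proof.
elim: n p => [|n IHn] p p0.
  exists (fun=> 0); apply: contra p0 => /eqP pv.
  apply/eqP/mpolyP => m; rewrite mcoeff0 -pv mevalE.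
  have mE (m' : 'X_{1..0}) : m' = 0%MM by apply/mnmP => -[].
  rewrite (mE m); have [sp|] := boolP (0%MM \in msupp p).
    rewrite (bigD1_seq 0%MM) //= [X in _ + X]big1 => [|m' /eqP].
      by rewrite big_ord0 mulr1 addr0.
    by rewrite (mE m').
  by move=> s0; rewrite memN_msupp_eq0.
have := mlead_supp p0; set m0 := mlead p => m0p.
(* The coefficient of [muni p] containing the monomial [m0] is a nonzero
   polynomial in one variable fewer. *)
pose r (m : 'X_{1..n.+1}) := [multinom m (widen_ord (leqnSn n) i) | i < n].
have [z qz] : exists z, ((muni p)`_(m0 ord_max)).@[z] != 0.
  apply: IHn; apply/eqP => /(congr1 (mcoeff (r m0))).
  rewrite muniE coef_sum raddf_sum /= mcoeff0 (bigD1_seq m0) //= big1.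
    rewrite coefZ coefXn eqxx mulr1 mcoeffZ mcoeffX eqxx mulr1 addr0.
    by move/eqP; rewrite mcoeff_eq0 m0p.
  move=> m mm0; rewrite coefZ coefXn; have [e|_] := eqVneq; last first.
    by rewrite mulr0 mcoeff0.
  rewrite mulr1 mcoeffZ mcoeffX; have [e'|] := eqVneq; last by rewrite mulr0.
  case/eqP: mm0; apply/mnmP => i; case: (unliftP ord_max i) => [j|] -> //.
  have -> : lift ord_max j = widen_ord (leqnSn n) j.
    by apply: val_inj => /=; rewrite /bump leqNgt ltn_ord.
  by move/mnmP: e' => /(_ j); rewrite !mnmE.
have [|x qx] := @poly_nonroot _ (map_poly (meval z) (muni p)).
  apply/eqP => /polyP /(_ (m0 ord_max)) /eqP.
  by rewrite coef_map coef0 (negPf qz).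
exists (fun i => if unlift ord_max i is Some j then z j else x).
apply: contra qx => /eqP <-; apply/eqP.
rewrite muniE rmorph_sum /= horner_sum mevalE; apply: eq_bigr => m _.
rewrite map_polyZ map_polyXn hornerZ hornerXn /= mevalZ mevalX -mulrA.
congr (_ * _); rewrite big_ord_recr /= unlift_none; congr (_ * _).
apply: eq_bigr => i _; have -> : widen_ord (leqnSn n) i = lift ord_max i.
  by apply: val_inj => /=; rewrite /bump leqNgt ltn_ord.
rewrite liftK mnmE; congr (_ ^+ m _).
by apply: val_inj => /=; rewrite /bump leqNgt ltn_ord.
Qed.

(** * Evaluation at generic points *)

(** The values [F_j(tau_k)], the points [tau_k] being the rows of [tau]. *)
Definition eval_mx (K : comNzRingType) (n m N : nat) (F : 'I_m -> {mpoly K[n]})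
    (tau : 'M[K]_(N, n)) : 'M[K]_(N, m) :=
  \matrix_(k, j) (F j).@[tau k].

(** [c] is the coefficient vector of a linear relation between the [F_j]. *)
Definition linrel (K : comNzRingType) (n m : nat) (F : 'I_m -> {mpoly K[n]})
    (c : 'cV[K]_m) : Prop :=
  \sum_j c j 0 *: F j = 0.

Section GenericEvaluation.

Variables (K : numFieldType) (n m : nat) (F : 'I_m -> {mpoly K[n]}).

Lemma eval_mx_mulE N (tau : 'M_(N, n)) (c : 'cV_m) k :
  (eval_mx F tau *m c) k 0 = (\sum_j c j 0 *: F j).@[tau k].
Proof.
rewrite mxE rmorph_sum /=; apply: eq_bigr => j _.
by rewrite mevalZ mxE mulrC.
Qed.

Lemma linrel_eval_mx N (tau : 'M_(N, n)) (c : 'cV_m) :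
  linrel F c -> eval_mx F tau *m c = 0.
Proof.
move=> Fc; apply/matrixP => k i; rewrite (ord1 i) eval_mx_mulE Fc.
by rewrite mxE meval0.
Qed.

Lemma eval_mx_add_point N (tau : 'M_(N, n)) (z : 'rV_n) :
  eval_mx F (col_mx z tau) = col_mx (eval_mx F z) (eval_mx F tau).
Proof.
apply/matrixP => k j; rewrite !mxE; case: splitP => i ki.
  rewrite mxE; apply: meval_eq => l.
  have -> : k = lshift N i by apply: val_inj; rewrite /= ki.
  by rewrite col_mxEu.
rewrite mxE; apply: meval_eq => l.
have -> : k = rshift 1 i by apply: val_inj; rewrite /= ki.
by rewrite col_mxEd.
Qed.

(** Either the greedy choice has raised the rank at each of the [N] steps, or
    it has already cut the kernel down to the linear relations. *)
Lemma exists_generic_points N :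
  exists tau : 'M_(N, n), \rank (eval_mx F tau) = N \/
    forall c, eval_mx F tau *m c = 0 -> linrel F c.
Proof.
elim: N => [|N [tau IH]].
  by exists 0; left; apply/eqP; rewrite -leqn0 rank_leq_row.
rewrite -add1n.
have [ok|] := pselect (forall c, eval_mx F tau *m c = 0 -> linrel F c).
  (* The additional point is irrelevant. *)
  exists (col_mx (0 : 'rV_n) tau); right => c.
  rewrite eval_mx_add_point mul_col_mx => /(congr1 dsubmx).
  by rewrite col_mxKd linear0 => /ok.
move=> /existsNP[c /not_implyP[tc Fc]].
case: IH => [rk|/(_ c tc) //].
have [v Fv] : exists v, (\sum_j c j 0 *: F j).@[v] != 0.
  by apply: mpoly_nonroot; apply/eqP.
exists (col_mx (\row_i v i : 'rV_n) tau); left; apply/eqP.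
rewrite eqn_leq rank_leq_row /=.
suff : (eval_mx F tau < eval_mx F (col_mx (\row_i v i : 'rV_n) tau))%MS.
  by rewrite ltmxErank rk => /andP[].
rewrite eval_mx_add_point ltmxE; apply/andP; split.
  by rewrite -addsmxE addsmxSr.
apply/negP; rewrite -addsmxE addsmx_sub submx_refl andbT => /submxP[D zD].
case/eqP: Fv; transitivity ((eval_mx F (\row_i v i) *m c) 0 0).
  by rewrite eval_mx_mulE; apply: meval_eq => i; rewrite mxE.
by rewrite zD -mulmxA tc mulmx0 mxE.
Qed.

Lemma exists_generic_eval :
  (exists2 c, c != 0 & linrel F c) ->
  exists tau : 'M_(m.-1, n),
    forall c, eval_mx F tau *m c = 0 -> linrel F c.
Proof.
move=> [c0 c00 Fc0]; have [tau [rk|]] := exists_generic_points m.-1; last first.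
  by exists tau.
(* Rank [m - 1] makes the kernel a line, which the given relation spans. *)
exists tau => c tc.
have m_gt0 : (0 < m)%N.
  rewrite lt0n; apply: contraNneq c00 => m0.
  by apply/eqP/colP => i; have := ltn_ord i; rewrite {2}m0.
have kerE : \rank (kermx (eval_mx F tau)^T) = 1%N.
  by rewrite mxrank_ker mxrank_tr rk; case: (m) m_gt0 => // k _; rewrite subSnn.
have sub (d : 'cV_m) :
    eval_mx F tau *m d = 0 -> (d^T <= kermx (eval_mx F tau)^T)%MS.
  by move=> td; apply/sub_kermxP; rewrite -trmx_mul td trmx0.
have c0E : (c0^T :=: kermx (eval_mx F tau)^T)%MS.
  apply/eqmxP; rewrite -(geq_leqif (mxrank_leqif_eq _)); last first.
    exact/sub/linrel_eval_mx.
  by rewrite kerE lt0n mxrank_eq0 trmx_eq0.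
have := sub c tc; rewrite -c0E => /sub_rVP[a ca].
have -> : c = a *: c0 by apply: trmx_inj; rewrite ca linearZ.
rewrite /linrel; under eq_bigr do rewrite mxE -scalerA.
by rewrite -scaler_sumr Fc0 scaler0.
Qed.

(** Genericity is expressed by a single polynomial [h] in the coordinates of
    the [m - 1] points, nonzero at some configuration. *)
Lemma generic_eval_kernel :
  (exists2 c, c != 0 & linrel F c) ->
  exists h : {mpoly K[m.-1 * n]},
    (exists z : 'rV_(m.-1 * n), h.@[fun i => z 0 i] != 0) /\
    forall tau : 'M_(m.-1, n), h.@[fun i => mxvec tau 0 i] != 0 ->
    forall c, eval_mx F tau *m c = 0 -> linrel F c.
Proof.
move=> /exists_generic_eval[tau0 tau0P].
(* With [r] the rank of [A = U *m V], [U] of size [m.-1 x r] and [V] of size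
   [r x m], the product of [A] by a left inverse of [U] and a right inverse of
   [V] is the identity of size [r].  The determinant of the same product with
   [A] replaced by the matrix of another configuration [tau] can only be nonzero
   if that matrix has rank at least [r]. *)
pose A := eval_mx F tau0.
pose coord (k : 'I_m.-1) := [tuple 'X_(mxvec_index k i) | i < n] :
  n.-tuple {mpoly K[m.-1 * n]}.
pose G := \matrix_(k, j) (F j \mPo coord k).
pose C := @mpolyC (m.-1 * n) K.
pose h := \det (map_mx C (pinvmx (col_base A)) *m G
                 *m map_mx C (pinvmx (row_base A))).
have hE tau : h.@[fun i => mxvec tau 0 i] =
    \det (pinvmx (col_base A) *m eval_mx F tau *m pinvmx (row_base A)).
  rewrite /h -det_map_mx /= !map_mxM /= -!map_mx_comp.
  have mapC p q (B : 'M[K]_(p, q)) :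
      map_mx (meval (fun i => mxvec tau 0 i) \o C) B = B.
    by apply/matrixP => i j; rewrite mxE /= mevalC.
  rewrite !mapC; congr (\det (_ *m _ *m _)); apply/matrixP => k j.
  rewrite !mxE comp_mpoly_meval; apply: meval_eq => i.
  by rewrite tnth_mktuple mevalXU mxvecE.
exists h; split.
  exists (mxvec tau0); rewrite hE -/A.
  suff -> : pinvmx (col_base A) *m A *m pinvmx (row_base A) = 1%:M.
    by rewrite det1 oner_neq0.
  transitivity (pinvmx (col_base A) *m (col_base A *m row_base A)
                  *m pinvmx (row_base A)); first by rewrite mulmx_base.
  by rewrite mulmxA mulVpmx ?col_base_full // mul1mx mulmxVp ?row_base_free.
move=> tau; rewrite hE => dn0 c tc; apply: (tau0P).
have AtauA : (eval_mx F tau <= A)%MS.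
  by apply: submx_of_ker => d /tau0P; apply: linrel_eval_mx.
have rk : (\rank A <= \rank (eval_mx F tau))%N.
  move: dn0; rewrite -unitfE -unitmxE => /mxrank_unit {1}<-.
  by rewrite (leq_trans (mxrankM_maxl _ _)) // mxrankM_maxr.
suff /submxP[D AD] : (A <= eval_mx F tau)%MS.
  by rewrite -/A AD -mulmxA tc mulmx0.
by rewrite -(geq_leqif (mxrank_leqif_sup AtauA)).
Qed.

End GenericEvaluation.

(** * Polynomials supported on lattice points *)

(** The exponent vector [v], meant for [v] with nonnegative entries. *)
Definition lat_exp (d : nat) (v : 'rV[int]_d) : 'X_{1..d} :=
  [multinom absz (v 0%R i) | i < d].

(** The polynomial [\sum_j c_j x^s_j]. *)
Definition lat_poly (R : nzRingType) (d : nat) (s : seq 'rV[int]_d)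
    (c : 'cV[R]_(size s)) : {mpoly R[d]} :=
  \sum_j c j 0 *: 'X_[lat_exp s`_j].

Lemma exprz_absz (K : fieldType) (x : K) (z : int) :
  0 <= z -> x ^ z = x ^+ absz z.
Proof. by move=> z0; rewrite -{1}(gez0_abs z0). Qed.

Section LatticePolynomials.

Variables (R : nzRingType) (d : nat) (s : seq 'rV[int]_d).

Lemma mmap_lat_poly (K : fieldType) (phi : {rmorphism R -> K}) (x : 'I_d -> K)
    (c : 'cV[R]_(size s)) :
  (forall v i, v \in s -> 0 <= v 0 i) ->
  mmap phi x (lat_poly c) = \sum_j phi (c j 0) * \prod_i x i ^ (s`_j 0 i).
Proof.
move=> s_ge0; rewrite /lat_poly raddf_sum /=; apply: eq_bigr => j _.
rewrite mmapZ mmapX; congr (_ * _); apply: eq_bigr => i _.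
by rewrite exprz_absz ?s_ge0 ?mem_nth // mnmE.
Qed.

(** The exponent of [x^a * x^m]; entries of [a] may be negative. *)
Definition shift_vec (a : 'rV[int]_d) (m : 'X_{1..d}) : 'rV[int]_d :=
  a + \row_i (m i)%:Z.

(** The coefficients of [x^a * p] on the monomials [x^s_j]. *)
Definition shift_coefs (a : 'rV[int]_d) (p : {mpoly R[d]}) : 'cV[R]_(size s) :=
  \col_j \sum_(m <- msupp p | shift_vec a m == s`_j) p@_m.

Variables (a : 'rV[int]_d) (p : {mpoly R[d]}).
Hypotheses (s_uniq : uniq s)
  (p_s : forall m, m \in msupp p -> shift_vec a m \in s).

Lemma shift_vec_inj : injective (shift_vec a).
Proof.
move=> m1 m2 /addrI /rowP e; apply/mnmP => i.
by have := e i; rewrite !mxE; case.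
Qed.

Lemma shift_coefs_neq0 : p != 0 -> shift_coefs a p != 0.
Proof.
move=> /mlead_supp; set m0 := mlead p => m0p.
have ms := p_s m0p; rewrite -index_mem in ms.
apply/eqP => /colP /(_ (Ordinal ms)) /eqP; rewrite !mxE /= nth_index ?p_s //.
rewrite big_mkcond (bigD1_seq m0) //= eqxx big1 => [|m mm0].
  by rewrite addr0; apply/eqP; rewrite mcoeff_eq0 m0p.
by rewrite (inj_eq (@shift_vec_inj)) (negPf mm0).
Qed.

(** The left-hand side is the value at [x] of [x^a * p], as soon as the
    exponents of this product all belong to [s]. *)
Lemma shift_coefs_sum (K : fieldType) (phi : {rmorphism R -> K})
    (x : 'I_d -> K) :
  (forall i, x i != 0) ->
  \sum_j phi (shift_coefs a p j 0) * \prod_i x i ^ (s`_j 0 i) =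
  (\prod_i x i ^ (a 0 i)) * mmap phi x p.
Proof.
move=> x0.
transitivity (\sum_(v <- s) \sum_(m <- msupp p | shift_vec a m == v)
    phi p@_m * \prod_i x i ^ (v 0 i)).
  rewrite (big_nth 0) big_mkord; apply: eq_bigr => j _.
  by rewrite mxE rmorph_sum /= mulr_suml.
rewrite (exchange_big_dep xpredT) //= /mmap mulr_sumr big_seq [RHS]big_seq.
apply: eq_bigr => m mp.
rewrite big_mkcond (bigD1_seq (shift_vec a m)) ?p_s //= eqxx.
rewrite [X in _ + X]big1 ?addr0 => [|v]; last by rewrite eq_sym => /negPf ->.
rewrite mulrCA; congr (_ * _); rewrite /mmap1 -big_split /=.
by apply: eq_bigr => i _; rewrite !mxE expfzDr.
Qed.

End LatticePolynomials.

(** * Clearing the denominators of the parameterization *)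

(** The monomial [x^v] at [x_i = f_i / g_i], multiplied by the common
    denominator [\prod_i g_i ^ D]; meaningful for [0 <= v_i <= D]. *)
Definition cleared (R : nzRingType) (n d : nat) (f g : 'I_d -> {mpoly R[n]})
    (D : nat) (v : 'rV[int]_d) : {mpoly R[n]} :=
  \prod_i (f i ^+ absz (v 0%R i) * g i ^+ (D - absz (v 0%R i))).

Section Cleared.

Variables (R : comNzRingType) (n d : nat).
Variables (f g : 'I_d -> {mpoly R[n]}) (D : nat).

Lemma cleared_morph (K : fieldType) (psi : {rmorphism {mpoly R[n]} -> K})
    (v : 'rV[int]_d) :
  (forall i, psi (g i) != 0) -> (forall i, 0 <= v 0 i) ->
  (forall i, absz (v 0%R i) <= D)%N ->
  psi (cleared f g D v) =
  (\prod_i psi (g i) ^+ D) * \prod_i (psi (f i) / psi (g i)) ^ (v 0 i).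
Proof.
move=> g0 v0 vD; rewrite -big_split rmorph_prod /=; apply: eq_bigr => i _.
rewrite exprz_absz // rmorphM !rmorphXn /= expr_div_n -{2}(subnK (vD i)) exprD.
by rewrite [RHS]mulrC -mulrA [_ ^+ (_ - _) * _]mulrC mulKf ?expf_neq0.
Qed.

End Cleared.

Lemma lattice_deg_bound d (s : seq 'rV[int]_d) (v : 'rV[int]_d) i :
  v \in s -> (absz (v 0%R i) <= \max_(w <- s) \max_i absz (w 0%R i))%N.
Proof.
move=> vs; rewrite (big_rem v) //= leq_max.
by apply/orP; left; apply: (leq_bigmax i).
Qed.

Section Parameterization.

Variables (R : realType) (n d : nat) (f g : 'I_d -> {mpoly R[n]}).
Variable s : seq 'rV[int]_d.
Hypothesis s_ge0 : forall v i, v \in s -> 0 <= v 0 i.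

Let D := (\max_(w <- s) \max_i absz (w 0%R i))%N.

(** The monomials [x^s_j] at [x_i = f_i / g_i] with denominators cleared, over
    the base field and over its complexification. *)
Definition num_fam (j : 'I_(size s)) : {mpoly R[n]} := cleared f g D s`_j.
Definition cnum_fam (j : 'I_(size s)) : {mpoly R[i][n]} :=
  map_mpoly (real_complex R) (num_fam j).

Lemma num_fam_morph (K : fieldType) (psi : {rmorphism {mpoly R[n]} -> K}) j :
  (forall i, psi (g i) != 0) ->
  psi (num_fam j) =
  (\prod_i psi (g i) ^+ D) * \prod_i (psi (f i) / psi (g i)) ^ (s`_j 0 i).
Proof.
move=> g0; apply: cleared_morph => // i; first by rewrite s_ge0 ?mem_nth.
by apply: lattice_deg_bound; rewrite mem_nth.
Qed.

Lemma linrel_vanishes (hg : forall i, g i != 0) (c : 'cV[R]_(size s)) :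
  linrel num_fam c <->
  \sum_j tofrac (c j 0)%:MP_[n] *
    \prod_i (tofrac (f i) / tofrac (g i)) ^ (s`_j 0 i) = 0.
Proof.
have g0 i : tofrac (g i) != 0 by rewrite tofrac_eq0.
set G := \prod_i tofrac (g i) ^+ D.
have G0 : G != 0 by apply/prodf_neq0 => i _; rewrite expf_neq0.
have E : tofrac (\sum_j c j 0 *: num_fam j) = G *
    \sum_j tofrac (c j 0)%:MP_[n] *
      \prod_i (tofrac (f i) / tofrac (g i)) ^ (s`_j 0 i).
  rewrite mulr_sumr rmorph_sum /=; apply: eq_bigr => j _.
  by rewrite -mul_mpolyC rmorphM /= num_fam_morph // mulrCA.
split=> [cF|S0].
  by move/eqP: E; rewrite cF tofrac0 eq_sym mulf_eq0 (negPf G0) => /eqP.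
by apply/eqP; rewrite -tofrac_eq0 E S0 mulr0.
Qed.

Lemma vanishes_lat_poly (hg : forall i, g i != 0) (c : 'cV[R]_(size s)) :
  vanishes_on_param f g (lat_poly c) <-> linrel num_fam c.
Proof.
rewrite linrel_vanishes // /vanishes_on_param.
by rewrite (@mmap_lat_poly _ _ _ _ (@tofrac {mpoly R[n]} \o @mpolyC n R)).
Qed.

Lemma linrel_Re_Im (c : 'cV[R[i]]_(size s)) : linrel cnum_fam c ->
  linrel num_fam (map_mx (@complex.Re R) c) /\
  linrel num_fam (map_mx (@complex.Im R) c).
Proof.
move=> cF; suff H m : \sum_j complex.Re (c j 0) * (num_fam j)@_m = 0 /\
    \sum_j complex.Im (c j 0) * (num_fam j)@_m = 0.
  split; apply/mpolyP => m; rewrite mcoeff0 raddf_sum /=.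
    by rewrite -[RHS](H m).1; apply: eq_bigr => j _; rewrite mcoeffZ mxE.
  by rewrite -[RHS](H m).2; apply: eq_bigr => j _; rewrite mcoeffZ mxE.
have := congr1 (mcoeff m) cF; rewrite mcoeff0 raddf_sum /=.
under eq_bigr do rewrite mcoeffZ mcoeff_map_mpoly.
move=> H; split.
  have := congr1 (@complex.Re R) H; rewrite raddf_sum /= => e; rewrite -[RHS]e.
  by apply: eq_bigr => j _; case: (c j 0) => x y /=; rewrite mulr0 subr0.
have := congr1 (@complex.Im R) H; rewrite raddf_sum /= => e; rewrite -[RHS]e.
by apply: eq_bigr => j _; case: (c j 0) => x y /=; rewrite mulr0 add0r.
Qed.

Lemma linrel_complex (c : 'cV[R]_(size s)) : linrel num_fam c ->
  linrel cnum_fam (map_mx (real_complex R) c).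
Proof.
move=> cF; rewrite /linrel.
rewrite -[RHS](rmorph0 (map_mpoly (real_complex R))) -[in RHS]cF.
by rewrite rmorph_sum; apply: eq_bigr => j _; rewrite /= map_mpolyZ mxE.
Qed.

(** The rows of the two matrices differ by nonzero factors. *)
Lemma interp_mx_ker N (tau : 'M[R[i]]_(N, n)) (c : 'cV_(size s)) :
  (forall k i, ceval (g i) (row k tau) != 0) ->
  interp_mx f g s tau *m c = 0 <-> eval_mx cnum_fam tau *m c = 0.
Proof.
move=> g0; pose G k := \prod_i ceval (g i) (row k tau) ^+ D.
have G0 k : G k != 0 by apply/prodf_neq0 => i _; rewrite expf_neq0.
have E : eval_mx cnum_fam tau = diag_mx (\row_k G k) *m interp_mx f g s tau.
  rewrite mul_diag_mx; apply/matrixP => k j; rewrite !mxE.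
  pose psi := meval (fun i => row k tau 0 i) \o map_mpoly (real_complex R).
  transitivity (psi (num_fam j)).
    by apply: meval_eq => i; rewrite mxE.
  have psi_g i : psi (g i) != 0 by exact: g0.
  apply: etrans (num_fam_morph (psi := psi) j psi_g) _.
  by congr (_ * _); apply: eq_bigr => i _; rewrite mxE.
split=> [H|]; first by rewrite E -mulmxA H mulmx0.
rewrite E -mulmxA mul_diag_mx => /colP H; apply/colP => k.
by have /eqP := H k; rewrite !mxE mulf_eq0 (negPf (G0 k)) => /eqP.
Qed.

End Parameterization.

(** * The predicted polytope and the query point *)

Section PredictedPolytope.

Variables (R : realType) (d : nat) (p : {mpoly R[d]}).
Variables (Q : set 'rV[R]_d) (s : seq 'rV[int]_d).
Hypotheses (hs : enumerates_lattice_points Q s) (pQ : predicted_polytope p Q).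

Lemma lattice_point_ge0 v i : v \in s -> 0 <= v 0 i.
Proof.
move=> /hs.2 Qv; have [_ Q_ge0 _ _] := pQ.
by have := Q_ge0 _ i Qv; rewrite mxE ler0z.
Qed.

Lemma msupp_newton_polytope m :
  m \in msupp p -> newton_polytope p (\row_i (m i)%:R).
Proof.
move=> mp.
set V := [seq (\row_i (m i)%:R : 'rV[R]_d) | m : 'X_{1..d} <- msupp p].
have kV : (index m (msupp p) < size V)%N by rewrite size_map index_mem.
exists (fun k => (k == Ordinal kV)%:R); split.
- by move=> k; rewrite ler0n.
- by rewrite (bigD1 (Ordinal kV)) //= eqxx big1 ?addr0 // => k /negPf ->.
rewrite (bigD1 (Ordinal kV)) //= eqxx scale1r big1 => [|k /negPf ->].
  by rewrite addr0 (nth_map m) ?index_mem // nth_index.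
by rewrite scale0r.
Qed.

(** Some translate of the support of [p] consists of lattice points of [Q]. *)
Lemma predicted_shift :
  exists a, forall m, m \in msupp p -> shift_vec a m \in s.
Proof.
have [_ _ [a aQ] _] := pQ; exists a => m /msupp_newton_polytope /aQ Qm.
apply/hs.2; congr (Q _): Qm; apply/rowP => i.
by rewrite !mxE intrD.
Qed.

End PredictedPolytope.

(** The translation [a] may have negative entries, so [x^a] is evaluated in the
    field of fractions, where [f i / g i] is nonzero. *)
Lemma implicit_shift_linrel (R : realType) (n d : nat)
    (f g : 'I_d -> {mpoly R[n]}) (hf : forall i, f i != 0)
    (hg : forall i, g i != 0) (s : seq 'rV[int]_d)
    (s_ge0 : forall v i, v \in s -> 0 <= v 0 i) (s_uniq : uniq s)
    (p : {mpoly R[d]}) (a : 'rV[int]_d) :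
  implicit_polynomial f g p ->
  (forall m, m \in msupp p -> shift_vec a m \in s) ->
  linrel (num_fam f g (s := s)) (shift_coefs s a p).
Proof.
move=> [_ pP] ps; apply/linrel_vanishes => //.
have x0 i : tofrac (f i) / tofrac (g i) != 0.
  by rewrite mulf_neq0 ?invr_eq0 ?tofrac_eq0.
have := shift_coefs_sum s_uniq ps (@tofrac {mpoly R[n]} \o @mpolyC n R) x0.
have p_van : vanishes_on_param f g p by apply/pP; exists 1; rewrite mul1r.
by move=> ->; rewrite [mmap _ _ _]p_van mulr0.
Qed.

Lemma implicit_linrel_eval (R : realType) (n d : nat)
    (f g : 'I_d -> {mpoly R[n]})
    (hg : forall i, g i != 0) (s : seq 'rV[int]_d)
    (s_ge0 : forall v i, v \in s -> 0 <= v 0 i)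
    (p : {mpoly R[d]}) (q : 'rV[R]_d) (c : 'cV[R]_(size s)) :
  implicit_polynomial f g p -> p.@[fun i => q 0 i] = 0 ->
  linrel (num_fam f g (s := s)) c ->
  monomial_row s q *m c = 0.
Proof.
move=> [_ pP] pq /vanishes_lat_poly => /(_ s_ge0 hg) /pP[r cE].
apply/rowP => i; rewrite (ord1 i) !mxE.
transitivity (lat_poly c).@[fun i => q 0 i]; last by rewrite cE mevalM pq mulr0.
rewrite /meval mmap_lat_poly //; apply: eq_bigr => j _.
by rewrite mxE mulrC.
Qed.

Lemma monomial_row_complex (R : realType) (d : nat) (s : seq 'rV[int]_d)
    (q : 'rV[R]_d) :
  monomial_row s (complex_point q) = map_mx (real_complex R) (monomial_row s q).
Proof.
apply/rowP => j; rewrite !mxE rmorph_prod /=; apply: eq_bigr => i _.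
by rewrite mxE fmorphXz.
Qed.

Theorem lemma9 (R : realType) (n : nat) (f g : 'I_n.+1 -> {mpoly R[n]})
    (hf : forall i, f i != 0) (hg : forall i, g i != 0)
    (Q : set 'rV[R]_n.+1) (s : seq 'rV[int]_n.+1)
    (hs : enumerates_lattice_points Q s) :
  exists U : set 'rV[R[i]]_((size s).-1 * n),
    [/\ zariski_open U, U !=set0 &
      forall p : {mpoly R[n.+1]},
        implicit_polynomial f g p -> predicted_polytope p Q ->
      forall tau : 'M[R[i]]_((size s).-1, n),
        U (mxvec tau) ->
        injective (fun k => row k tau) ->
        (forall k i, ceval (g i) (row k tau) != 0) ->
      forall q : 'rV[R]_n.+1,
        (forall i, q 0 i != 0) ->
        (forall k, complex_point q <> param_point f g (row k tau)) ->
        p.@[fun i => q 0 i] = 0 <->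
        corank (query_mx f g s tau q) = corank (interp_mx f g s tau)].
Proof.
have [[p0 [p0i p0Q]]|nop] := pselect
    (exists p, implicit_polynomial f g p /\ predicted_polytope p Q); last first.
  (* Without such a [p] nothing is required of [U] beyond being open and
     nonempty. *)
  exists setT; split; last by move=> p pi pQ; case: nop; exists p.
    exists [set 1]; apply/seteqP; split=> // z _.
    by exists 1; rewrite // meval1 oner_neq0.
  by exists 0.
have s_ge0 := lattice_point_ge0 hs p0Q.
have [h [[z hz] hP]] : exists h : {mpoly R[i][(size s).-1 * n]},
    (exists z : 'rV_((size s).-1 * n), h.@[fun i => z 0 i] != 0) /\
    forall tau : 'M_((size s).-1, n), h.@[fun i => mxvec tau 0 i] != 0 ->
    forall c, eval_mx (cnum_fam f g (s := s)) tau *m c = 0 ->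
      linrel (cnum_fam f g (s := s)) c.
  apply: generic_eval_kernel; have [a ap] := predicted_shift hs p0Q.
  exists (map_mx (real_complex R) (shift_coefs s a p0)).
    by rewrite map_mx_eq0 (shift_coefs_neq0 ap) // p0i.1.
  exact/linrel_complex/(implicit_shift_linrel hf hg s_ge0 hs.1 p0i).
exists [set z | h.@[fun i => z 0 i] != 0]; split.
- exists [set h]; apply/seteqP; split=> x /=; first by exists h.
  by move=> [_ ->].
- by exists z.
move=> p pi pQ tau /= htau _ gtau q q0 _.
rewrite /query_mx corank_col_mx; split=> [pq|/submxP[D qD]].
  apply: submx_of_ker => c /(interp_mx_ker f s_ge0 c gtau) /(hP _ htau).
  move=> /linrel_Re_Im[cRe cIm].
  have := implicit_linrel_eval hg s_ge0 pi pq cIm.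
  have := implicit_linrel_eval hg s_ge0 pi pq cRe.
  rewrite monomial_row_complex => qRe qIm.
  have -> : c = map_mx (real_complex R) (map_mx (@complex.Re R) c) +
      'i%C *: map_mx (real_complex R) (map_mx (@complex.Im R) c).
    by apply/colP => j; rewrite !mxE [LHS]complexE.
  by rewrite mulmxDr -scalemxAr -!map_mxM qRe qIm !map_mx0 scaler0 addr0.
have [a ap] := predicted_shift hs pQ.
have := implicit_shift_linrel hf hg s_ge0 hs.1 pi ap.
move=> /linrel_complex /(linrel_eval_mx tau) /(interp_mx_ker f s_ge0 _ gtau) tc.
have : monomial_row s (complex_point q) *m
    map_mx (real_complex R) (shift_coefs s a p) = 0.
  by rewrite qD -mulmxA tc mulmx0.
rewrite monomial_row_complex -map_mxM => /eqP; rewrite map_mx_eq0 => /eqP.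
move=> /rowP /(_ 0); rewrite mxE [RHS]mxE => H.
have := shift_coefs_sum hs.1 ap idfun q0.
have qa0 : \prod_i q 0 i ^ a 0 i != 0.
  by apply/prodf_neq0 => i _; exact: expfz_neq0.
move=> qE; apply: (mulfI qa0); rewrite mulr0 -[RHS]H; apply: etrans (esym qE) _.
by apply: eq_bigr => j _; rewrite [monomial_row _ _ _ _]mxE mulrC.
Qed.
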